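(* Let $n\ge 0$ be an integer. There is a bijection between the set of new intervals of $\mathrm{Tam}_{n+1}$ and the set of modern interval-posets of size $n$.
   Context: **Binary trees and the Tamari lattice.** A (planar) binary tree of size $n$ is a rooted planar tree with $n$ inner vertices, each having a left child and a right child (each child is an inner vertex or a leaf); it has $n+1$ leaves, labelled $1,\dots,n+1$ from left to right. Write $X\wedge Z$ for the tree whose root has left subtree $X$ and right subtree $Z$. $\mathrm{Tam}_n$ is the set of binary trees of size $n$, ordered by the reflexive transitive closure of the covering relation in which a tree is covered by any tree obtained from it by replacing one subtree of the form $(A\wedge B)\wedge C$ by $A\wedge(B\wedge C)$. **New intervals.** For $T\in\mathrm{Tam}_p$, $S\in\mathrm{Tam}_q$ and $1\le i\le p+1$, $T\circ_i S\in\mathrm{Tam}_{p+q}$ is the tree obtained by grafting the root of $S$ on the $i$-th leaf of $T$. The $i$-th grafting of the interval $[S_2,T_2]$ on $[S_1,T_1]$ is the interval $[S_1\circ_i S_2,\,T_1\circ_i T_2]$. An interval is new if it cannot be obtained as the grafting of two intervals (of trees of sizes $p,q\ge 1$). **Modern interval-posets.** An interval-poset of size $n$ is a (reflexive) partial order $\lhd$ on $\{1,\dots,n\}$ such that for all $a<b<c$: $a\lhd c$ implies $b\lhd c$, and $c\lhd a$ implies $b\lhd a$. It is modern if there are no $x<y<z$ with both $x\lhd y$ and $z\lhd y$ (all relations are considered, not only cover relations). *)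

(* Defs.v *)
From mathcomp Require Import all_boot.
From mathcomp Require Import boolp classical_sets functions.
From Stdlib Require Import Relation_Operators.

Set Implicit Arguments.
Unset Strict Implicit.
Unset Printing Implicit Defensive.

Inductive bintree : Type :=
| Leaf : bintree
| Node : bintree -> bintree -> bintree.

Fixpoint tree_size (T : bintree) : nat :=
  match T with
  | Leaf => 0
  | Node L R => (tree_size L + tree_size R).+1
  end.

Inductive tamari_cover : bintree -> bintree -> Prop :=
| cover_root (A B C : bintree) :
    tamari_cover (Node (Node A B) C) (Node A (Node B C))
| cover_left (L L' R : bintree) :
    tamari_cover L L' -> tamari_cover (Node L R) (Node L' R)
| cover_right (L R R' : bintree) :
    tamari_cover R R' -> tamari_cover (Node L R) (Node L R').

Definition tamari_le : bintree -> bintree -> Prop :=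
  clos_refl_trans bintree tamari_cover.

(* An interval [S, T] is represented by the pair (S, T) of its endpoints. *)
Definition tamari_interval (n : nat) (I : bintree * bintree) : Prop :=
  [/\ tree_size I.1 = n, tree_size I.2 = n & tamari_le I.1 I.2].

(* Leaves are numbered from 1, left to right, and L has (tree_size L).+1
   leaves; the value is only meaningful for 1 <= i <= (tree_size T).+1. *)
Fixpoint graft (T : bintree) (i : nat) (S : bintree) : bintree :=
  match T with
  | Leaf => S
  | Node L R =>
      if i <= (tree_size L).+1 then Node (graft L i S) R
      else Node L (graft R (i - (tree_size L).+1) S)
  end.

Definition graft_interval (I1 : bintree * bintree) (i : nat)
    (I2 : bintree * bintree) : bintree * bintree :=
  (graft I1.1 i I2.1, graft I1.2 i I2.2).

Definition is_grafting (I : bintree * bintree) : Prop :=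
  exists (p q i : nat) (I1 I2 : bintree * bintree),
    [/\ 1 <= p, 1 <= q & 1 <= i <= p.+1] /\
    [/\ tamari_interval p I1, tamari_interval q I2 &
        I = graft_interval I1 i I2].

Definition new_interval (n : nat) (I : bintree * bintree) : Prop :=
  tamari_interval n I /\ ~ is_grafting I.

(* A relation on {1, ..., n} is encoded, with labels shifted to 0, ..., n-1,
   by its graph: (a, b) \in P stands for a <| b. *)
Definition graph_rel (n : nat) (P : {set 'I_n * 'I_n}) : rel 'I_n :=
  fun a b => (a, b) \in P.

Definition interval_poset (n : nat) (P : {set 'I_n * 'I_n}) : Prop :=
  let r := graph_rel P in
  [/\ reflexive r, antisymmetric r, transitive r,
      (forall a b c : 'I_n, a < b -> b < c -> r a c -> r b c) &
      (forall a b c : 'I_n, a < b -> b < c -> r c a -> r b a)].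

Definition modern (n : nat) (P : {set 'I_n * 'I_n}) : Prop :=
  let r := graph_rel P in
  ~ exists x y z : 'I_n, [/\ x < y, y < z, r x y & r z y].

(* Main.v *)
Require Import Defs.
From mathcomp Require Import all_boot.
From mathcomp Require Import boolp classical_sets functions.
From mathcomp Require Import zify.
From Stdlib Require Import Relation_Operators.

(** Number the inner vertices of a tree in infix order, and attach to a pair of
    trees [(S, T)] of size [n] the relation in which, for [a < b], [b <| a]
    means that [b] is in the right subtree of [a] in [S], and [a <| b] means
    that [a] is in the left subtree of [b] in [T].  Right subtrees determine
    [S], left subtrees determine [T], and a family of segments starting after
    (ending before) each vertex comes from a tree as soon as it is nested.
    Hence the relation determines the pair ([interval_graph_inj]), and every
    interval-poset arises ([interval_graph_surj]).  The Tamari order [S <= T]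
    means that no vertex has a larger right subtree in [S] than in [T];
    equivalently no [a < b] are related in both directions ([tamari_leP]).

    An interval is a grafting exactly when its two ends have a proper subtree on
    the same block of vertices.  In a new interval the left subtree of the root
    of the upper tree is empty, since otherwise the vertices of this subtree
    would form a subtree of the lower tree too; dually for the lower tree.
    So a new interval of size [n + 1] has the form
    [(Node S Leaf, Node Leaf T)] ([new_interval_rise]).  Passing from [T] to
    [Node Leaf T] shifts the vertices by one, so a common subtree
    [c, ..., d] of the larger trees turns into a pair [c - 1, d] that is related
    both ways by [(S, T)], while a pair [y, y + 1] related both ways by the
    larger trees turns into relations [y - 1 <| y] and [y + 1 <| y] for
    [(S, T)].  This gives the key equivalence: [(Node S Leaf, Node Leaf T)] is a
    new interval if and only if the relation of [(S, T)] is antisymmetric and modern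
    ([new_rise_modern], [modern_rise_new]).  The bijection sends
    [(Node S Leaf, Node Leaf T)] to the relation of [(S, T)]. *)

Set Implicit Arguments.
Unset Strict Implicit.
Unset Printing Implicit Defensive.

(** * Right and left subtree sizes *)

(** Inner vertices are numbered from 0 in infix order, so that the subtree at
    [i] consists of the consecutive vertices [i - lsize T i], ...,
    [i + rsize T i].  The function [rsize T] is the bracket vector of [T]. *)
Fixpoint rsize (T : bintree) (i : nat) : nat :=
  match T with
  | Leaf => 0
  | Node A B =>
      if i < tree_size A then rsize A i
      else if i == tree_size A then tree_size B
      else rsize B (i - (tree_size A).+1)
  end.

Fixpoint lsize (T : bintree) (i : nat) : nat :=
  match T with
  | Leaf => 0
  | Node A B =>
      if i < tree_size A then lsize A i
      else if i == tree_size A then tree_size A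
      else lsize B (i - (tree_size A).+1)
  end.

Fixpoint mirror (T : bintree) : bintree :=
  match T with
  | Leaf => Leaf
  | Node A B => Node (mirror B) (mirror A)
  end.

Lemma rsize_lt (A B : bintree) i :
  i < tree_size A -> rsize (Node A B) i = rsize A i.
Proof. by rewrite /= => ->. Qed.

Lemma rsize_root (A B : bintree) : rsize (Node A B) (tree_size A) = tree_size B.
Proof. by rewrite /= ltnn eqxx. Qed.

Lemma rsize_gt (A B : bintree) i :
  rsize (Node A B) ((tree_size A).+1 + i) = rsize B i.
Proof. by rewrite /= !ifF //; [congr rsize|..]; lia. Qed.

Lemma lsize_lt (A B : bintree) i :
  i < tree_size A -> lsize (Node A B) i = lsize A i.
Proof. by rewrite /= => ->. Qed.

Lemma lsize_root (A B : bintree) : lsize (Node A B) (tree_size A) = tree_size A.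
Proof. by rewrite /= ltnn eqxx. Qed.

Lemma lsize_gt (A B : bintree) i :
  lsize (Node A B) ((tree_size A).+1 + i) = lsize B i.
Proof. by rewrite /= !ifF //; [congr lsize|..]; lia. Qed.

Variant node_position (A B : bintree) : nat -> Type :=
| InLeft i of i < tree_size A : node_position A B i
| AtRoot : node_position A B (tree_size A)
| InRight i : node_position A B ((tree_size A).+1 + i).

Lemma nodeP (A B : bintree) i : node_position A B i.
Proof.
case: (ltngtP i (tree_size A)) => [lt|gt|->]; first exact: InLeft.
  by rewrite -(subnKC gt); exact: InRight.
exact: AtRoot.
Qed.

Lemma size_mirror (T : bintree) : tree_size (mirror T) = tree_size T.
Proof. by elim: T => //= A -> B ->; rewrite addnC. Qed.

Lemma mirrorK : involutive mirror.
Proof. by elim=> //= A -> B ->. Qed.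

(** Reversing the infix order exchanges [lsize] and [rsize]; this transports
    the facts about one to the other. *)
Lemma rsize_mirror (T : bintree) i :
  i < tree_size T -> rsize (mirror T) i = lsize T ((tree_size T).-1 - i).
Proof.
elim: T i => // A IHA B IHB i.
rewrite [mirror _]/= [tree_size _]/=.
case: (nodeP (mirror B) (mirror A) i) => [j||j]; rewrite !size_mirror => lt.
- move=> _; rewrite rsize_lt ?size_mirror // IHB //.
  by rewrite -(lsize_gt A B); congr lsize; lia.
- have := rsize_root (mirror B) (mirror A); rewrite !size_mirror => ->.
  by rewrite -{1}(lsize_root A B); congr lsize; lia.
- have := rsize_gt (mirror B) (mirror A) j; rewrite size_mirror => ->.
  rewrite IHA; last by lia.
  by rewrite -(@lsize_lt A B); [congr lsize|]; lia.
Qed.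

Lemma lsize_mirror (T : bintree) i :
  i < tree_size T -> lsize (mirror T) i = rsize T ((tree_size T).-1 - i).
Proof.
move=> lt; rewrite -{2}[T]mirrorK rsize_mirror size_mirror; last by lia.
by congr lsize; lia.
Qed.

Lemma rsize_bound (T : bintree) i :
  i < tree_size T -> i + rsize T i < tree_size T.
Proof.
elim: T i => // A IHA B IHB i.
case: (nodeP A B i) => [j lt _|_|j].
- by rewrite rsize_lt //=; have := IHA _ lt; lia.
- by rewrite rsize_root /=; lia.
- by rewrite rsize_gt /= => lt; have := IHB j; lia.
Qed.

Lemma lsize_bound (T : bintree) i : i < tree_size T -> lsize T i <= i.
Proof.
move=> lt; have := @rsize_bound (mirror T) ((tree_size T).-1 - i).
rewrite size_mirror rsize_mirror; last by lia.
by rewrite subKn; lia.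
Qed.

Lemma rsize_nest (T : bintree) i j :
  i < tree_size T -> i < j -> j <= i + rsize T i ->
  j + rsize T j <= i + rsize T i.
Proof.
elim: T i j => // A IHA B IHB i j.
case: (nodeP A B i) => [{}i lti||{}i]; case: (nodeP A B j) => [{}j ltj||{}j];
  rewrite ?(rsize_root, rsize_gt, rsize_lt) //=; try lia.
- by move=> _; apply: IHA.
- by have := rsize_bound lti; lia.
- by have := rsize_bound lti; lia.
- by have := @rsize_bound B j; lia.
- by move=> li lij leR; have := IHB i j; lia.
Qed.

Lemma lsize_nest (T : bintree) i j :
  j < i -> i < tree_size T -> i <= j + lsize T i ->
  i + lsize T j <= j + lsize T i.
Proof.
move=> ji lt le.
pose n := tree_size T.
have := @rsize_nest (mirror T) (n.-1 - i) (n.-1 - j).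
rewrite size_mirror !rsize_mirror; try lia.
have -> : n.-1 - (n.-1 - i) = i by lia.
have -> : n.-1 - (n.-1 - j) = j by lia.
by have := lsize_bound lt; have := @lsize_bound T j; rewrite /n; lia.
Qed.

(** The bracket vector determines the left sizes: [j] is in the left subtree of
    [i] exactly when no vertex of [j, ..., i - 1] has [i] in its right subtree. *)
Lemma lsize_rsizeP (T : bintree) i j : j < i -> i < tree_size T ->
  i <= j + lsize T i <-> (forall k, j <= k -> k < i -> k + rsize T k < i).
Proof.
elim: T i j => // A IHA B IHB i j.
case: (nodeP A B i) => [{}i lti||{}i] ji.
- move=> _; rewrite lsize_lt //; apply: (iff_trans (IHA _ _ ji lti)).
  by split=> h k jk ki; have := h k jk ki; rewrite rsize_lt; lia.
- move=> _; rewrite lsize_root; split=> [_ k _ kA|_]; last by lia.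
  by rewrite rsize_lt //; exact: rsize_bound.
- rewrite lsize_gt [tree_size (Node _ _)]/= => lti.
  case: (nodeP A B j) ji => [{}j ltj||{}j] ji.
  + split=> [|h]; first by have := @lsize_bound B i; lia.
    by have := h (tree_size A); rewrite rsize_root; lia.
  + split=> [|h]; first by have := @lsize_bound B i; lia.
    by have := h (tree_size A); rewrite rsize_root; lia.
  + have jiB : j < i by lia.
    have liB : i < tree_size B by lia.
    have [h1 h2] := IHB i j jiB liB; split=> [le k jk ki|h].
      have -> : k = (tree_size A).+1 + (k - (tree_size A).+1) by lia.
      rewrite rsize_gt; have := h1 _ (k - (tree_size A).+1); lia.
    suff : i <= j + lsize B i by lia.
    apply: h2 => k jk ki.
    by have := h ((tree_size A).+1 + k); rewrite rsize_gt; lia.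
Qed.

Lemma rsize_inj (S T : bintree) : tree_size S = tree_size T ->
  (forall i, i < tree_size S -> rsize S i = rsize T i) -> S = T.
Proof.
elim: S T => [|A IHA B IHB] [|A' B'] //= [sz] h.
have eA : tree_size A = tree_size A'.
  have := h (tree_size A); have := h (tree_size A').
  rewrite !ltnn !eqxx.
  case: (ltngtP (tree_size A) (tree_size A')) => // lt.
    by have := @rsize_bound A' (tree_size A) lt; lia.
  by have := @rsize_bound A (tree_size A') lt; lia.
have eB : tree_size B = tree_size B' by lia.
congr Node; [apply: IHA|apply: IHB] => // i lt.
- by have := h i; rewrite -eA lt; apply; lia.
- have := h ((tree_size A).+1 + i).
  by rewrite -!/(rsize (Node _ _) _) rsize_gt eA rsize_gt; apply; lia.
Qed.

(** The bounds and the nesting property characterize bracket vectors: the root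
    has to be the first vertex whose right subtree reaches the end, and nesting
    then separates what lies on its two sides. *)
Lemma rsize_surj n (f : nat -> nat) :
  (forall i, i < n -> i + f i < n) ->
  (forall i j, i < n -> i < j -> j <= i + f i -> j + f j <= i + f i) ->
  exists T, tree_size T = n /\ forall i, i < n -> rsize T i = f i.
Proof.
elim/ltn_ind: n f => -[|n] IH f bnd nest; first by exists Leaf.
have ex : exists k, (k <= n) && (n <= k + f k).
  by exists n; rewrite leqnn leq_addr.
case: (ex_minnP ex) => k /andP[kn nk] kmin.
have kf : k + f k = n by have := bnd k; lia.
have below i : i < k -> i + f i < k.
  by move=> ik; have := kmin i; have := nest i k; lia.
have [//||A [szA rA]] := IH k kn f.
  by move=> i j ik; apply: nest; lia.
have nkn : n - k < n.+1 by lia.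
have [||B [szB rB]] := IH (n - k) nkn (fun i => f (k.+1 + i)).
- by move=> i ik; have := bnd (k.+1 + i); lia.
- by move=> i j ik ij jf; have := nest (k.+1 + i) (k.+1 + j); lia.
exists (Node A B); split=> [/=|i]; first by lia.
case: (nodeP A B i) => [{}i lti||{}i] lt;
  rewrite ?(rsize_root, rsize_gt, rsize_lt) //.
- by rewrite rA; lia.
- by rewrite szA szB; lia.
- by rewrite rB ?szA //; move: lt => /=; lia.
Qed.

(** [D a b], for [a < b], prescribes that [b] be in the right subtree of [a].
    Such a prescription is realizable as soon as it describes initial segments
    and is transitive, transitivity being the nesting property. *)
Lemma rsize_realize n (D : rel nat) :
  (forall a b c, a < b -> b < c -> c < n -> D a c -> D a b) ->
  (forall a b c, a < b -> b < c -> c < n -> D a b -> D b c -> D a c) ->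
  exists T, tree_size T = n /\
    forall a b, a < b -> b < n -> (b <= a + rsize T a) = D a b.
Proof.
move=> down trans.
pose f a := \max_(b < n | (a < b) && D a b) (b - a).
have fP a b : a < b -> b < n -> (b <= a + f a) = D a b.
  move=> ab bn; apply/idP/idP => [le|Dab].
    have [c /andP[ac Dac] fc] : {c : 'I_n | (a < c) && D a c & f a = c - a}.
      apply: eq_bigmax_cond; rewrite lt0n; apply/negP => /eqP/card0_eq no.
      move: le; rewrite /f big_pred0 => [|c]; first by lia.
      by have := no c; rewrite inE.
    case: (ltngtP b c) => [bc|cb|->] //; last by lia.
    exact: down bc (ltn_ord c) Dac.
  have := @leq_bigmax_cond _ (fun c : 'I_n => (a < c) && D a c)
            (fun c : 'I_n => c - a) (Ordinal bn).
  by rewrite /= ab Dab => /(_ isT); rewrite -/(f a); lia.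
have bnd a : a < n -> a + f a < n.
  move=> an; suff : f a <= n.-1 - a by lia.
  by apply/bigmax_leqP => c _; have := ltn_ord c; lia.
have [|T [szT rT]] := @rsize_surj n f bnd.
  move=> a b an ab le.
  have bn : b < n by have := bnd a an; lia.
  case: (posnP (f b)) => [->|pos]; first by lia.
  have cn := bnd b bn.
  rewrite fP //; last by lia.
  by apply: (trans a b); rewrite -?fP //; lia.
by exists T; split=> // a b ab bn; rewrite rT ?fP //; lia.
Qed.

Lemma lsize_realize n (D : rel nat) :
  (forall a b c, a < b -> b < c -> c < n -> D c a -> D c b) ->
  (forall a b c, a < b -> b < c -> c < n -> D c b -> D b a -> D c a) ->
  exists T, tree_size T = n /\
    forall a b, a < b -> b < n -> (b <= a + lsize T b) = D b a.
Proof.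
move=> up trans.
have [||T [szT rT]] := @rsize_realize n (fun a b => D (n.-1 - a) (n.-1 - b)).
- by move=> a b c *; apply: (up (n.-1 - c)); lia.
- by move=> a b c *; apply: (trans _ (n.-1 - b)); lia.
exists (mirror T); rewrite size_mirror; split=> // a b ab bn.
rewrite lsize_mirror szT //.
have := rT (n.-1 - b) (n.-1 - a).
have -> : n.-1 - (n.-1 - a) = a by lia.
have -> : n.-1 - (n.-1 - b) = b by lia.
by move=> <-; lia.
Qed.

Lemma lsize_inj (S T : bintree) : tree_size S = tree_size T ->
  (forall i, i < tree_size S -> lsize S i = lsize T i) -> S = T.
Proof.
move=> sz h; apply: (can_inj mirrorK); apply: rsize_inj;
  rewrite !size_mirror //.
by move=> i lt; rewrite !rsize_mirror -?sz //; apply: h; lia.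
Qed.

(** * The Tamari order in terms of subtree sizes *)

Lemma tamari_le_node (A A' B B' : bintree) :
  tamari_le A A' -> tamari_le B B' -> tamari_le (Node A B) (Node A' B').
Proof.
move=> lA lB; apply: (@rt_trans _ _ _ (Node A' B)).
  elim: lA => [x y c|x|x y z _ h1 _ h2];
    [by apply: rt_step; constructor|exact: rt_refl|exact: rt_trans h1 h2].
elim: lB => [x y c|x|x y z _ h1 _ h2];
  [by apply: rt_step; constructor|exact: rt_refl|exact: rt_trans h1 h2].
Qed.

Lemma tamari_cover_rsize (S T : bintree) : tamari_cover S T ->
  tree_size S = tree_size T /\
  forall i, i < tree_size S -> rsize S i <= rsize T i.
Proof.
elim=> [A B C|L L' R _ [sz h]|L R R' _ [sz h]].
- split=> [/=|i _]; first by lia.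
  case: (nodeP (Node A B) C i) => [{}i lti||{}i].
  + rewrite rsize_lt //; case: (nodeP A B i) lti => [{}i lt||{}i] lti.
    * by rewrite !rsize_lt.
    * by rewrite !rsize_root /=; lia.
    * by rewrite !rsize_gt rsize_lt //; move: lti => /=; lia.
  + rewrite rsize_root.
    have -> : tree_size (Node A B) = (tree_size A).+1 + tree_size B by [].
    by rewrite rsize_gt rsize_root.
  + rewrite rsize_gt.
    have -> : (tree_size (Node A B)).+1 + i
            = (tree_size A).+1 + ((tree_size B).+1 + i) by rewrite /=; lia.
    by rewrite !rsize_gt.
- split=> [/=|i]; first by lia.
  case: (nodeP L R i) => [{}i lt||{}i] _.
  + by rewrite !rsize_lt -?sz //; exact: h.
  + by rewrite rsize_root sz rsize_root.
  + by rewrite rsize_gt sz rsize_gt.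
- split=> [/=|i]; first by lia.
  case: (nodeP L R i) => [{}i lt||{}i]; rewrite ?rsize_root ?rsize_gt /= => ?.
  + by rewrite lt.
  + by lia.
  + by apply: h; lia.
Qed.

Lemma tamari_le_size_rsize (S T : bintree) : tamari_le S T ->
  tree_size S = tree_size T /\
  forall i, i < tree_size S -> rsize S i <= rsize T i.
Proof.
elim=> [x y /tamari_cover_rsize //|//|x y z _ [sz1 h1] _ [sz2 h2]].
split=> [|i lt]; first by rewrite sz1.
by apply: leq_trans (h1 i lt) (h2 i _); rewrite -sz1.
Qed.

(** If no vertex before [k] has [k] in its right subtree, then [k] is on the
    leftmost branch of [S], and rotating along this branch brings it to the
    root.  These rotations leave the sizes of the right subtrees of the vertices
    before and after [k] unchanged. *)
Lemma tamari_lift_root (S : bintree) k : k < tree_size S ->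
  (forall i, i < k -> i + rsize S i < k) ->
  exists X Y, [/\ tree_size X = k, tree_size S = (k + tree_size Y).+1,
    tamari_le S (Node X Y),
    forall i, i < k -> rsize X i = rsize S i &
    forall i, i < tree_size Y -> rsize Y i = rsize S (k.+1 + i)].
Proof.
elim: S k => // A IHA B _ k.
case: (nodeP A B k) => [{}k lt _ h||{}k ltk h].
- have [i ik|X [Y [szX szA le hX hY]]] := IHA k lt.
    by have := h i ik; rewrite rsize_lt //; lia.
  exists X, (Node Y B); split=> // [/=|||i]; first by lia.
  + apply: (@rt_trans _ _ _ (Node (Node X Y) B)); last first.
      by apply: rt_step; constructor.
    by apply: tamari_le_node le _; exact: rt_refl.
  + by move=> i ik; rewrite hX // rsize_lt //; lia.
  + case: (nodeP Y B i) => [{}i lti||{}i] _.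
    * by rewrite rsize_lt // rsize_lt ?hY //; lia.
    * have -> : k.+1 + tree_size Y = tree_size A by lia.
      by rewrite !rsize_root.
    * have -> : k.+1 + ((tree_size Y).+1 + i) = (tree_size A).+1 + i by lia.
      by rewrite !rsize_gt.
- move=> _ _; exists A, B; split=> // [|i lt|i lt]; first exact: rt_refl.
  + by rewrite rsize_lt.
  + by rewrite rsize_gt.
- by have := h (tree_size A); rewrite rsize_root; move: ltk => /=; lia.
Qed.

(** Lift in [S] the vertex that is the root of [T], then compare the two
    subtrees separately. *)
Lemma rsize_tamari_le (S T : bintree) : tree_size S = tree_size T ->
  (forall i, i < tree_size S -> rsize S i <= rsize T i) -> tamari_le S T.
Proof.
elim: T S => [|A IHA B IHB] S sz h.
  by case: S sz {h} => // _; exact: rt_refl.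
have sz' : tree_size S = (tree_size A + tree_size B).+1 := sz.
have [|i lt|X [Y [szX szS le hX hY]]] := @tamari_lift_root S (tree_size A).
- by lia.
- have := h i; rewrite rsize_lt //.
  by have := rsize_bound lt; lia.
apply: (rt_trans _ _ _ _ _ le); apply: tamari_le_node.
- apply: IHA => // i lt; rewrite hX -?szX //.
  by have := h i; rewrite rsize_lt -?szX //; apply; lia.
- apply: IHB => [|i lt]; first by lia.
  rewrite hY //.
  by have := h ((tree_size A).+1 + i); rewrite rsize_gt; apply; lia.
Qed.

(** The Tamari order stated on the lower tree's right subtrees and the upper
    tree's left subtrees: these are the two kinds of relations of the
    interval-poset, and a clash would violate antisymmetry. *)
Definition clash_free (S T : bintree) : Prop :=
  forall a b, a < b -> b < tree_size S ->
    b <= a + rsize S a -> b <= a + lsize T b -> False.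

(** By [lsize_rsizeP], the first vertex following the right subtree of [a] in
    [T] has [a] in its left subtree; if [rsize S a] exceeds [rsize T a], this
    vertex and [a] clash. *)
Lemma tamari_leP (S T : bintree) : tree_size S = tree_size T ->
  tamari_le S T <-> clash_free S T.
Proof.
move=> sz; split=> [/tamari_le_size_rsize[_ h] a b ab bn leR leL|free].
  have bT : b < tree_size T by lia.
  have [/(_ leL a) + _] := lsize_rsizeP ab bT.
  by have := h a; lia.
apply: rsize_tamari_le => // i lt.
case: (leqP (rsize S i) (rsize T i)) => // gt.
have bnd := rsize_bound lt.
case: (free i (i + rsize T i).+1); [lia..|].
apply/lsize_rsizeP; [lia..|] => k ik kb.
case: (ltngtP i k) => [lik||<-]; [|lia..].
by have := @rsize_nest T i k; lia.
Qed.

(** * Graftings and common subtrees *)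

Lemma graft_left (A B S : bintree) i : i <= tree_size A ->
  graft (Node A B) i.+1 S = Node (graft A i.+1 S) B.
Proof. by rewrite /= ltnS => ->. Qed.

Lemma graft_right (A B S : bintree) i :
  graft (Node A B) ((tree_size A).+1 + i).+1 S = Node A (graft B i.+1 S).
Proof. by rewrite /= ifF; [congr (Node _ (graft _ _ _))|]; lia. Qed.

Variant leaf_position (A B : bintree) : nat -> Type :=
| LeafInLeft i of i <= tree_size A : leaf_position A B i
| LeafInRight i : leaf_position A B ((tree_size A).+1 + i).

Lemma leafP (A B : bintree) i : leaf_position A B i.
Proof.
case: (leqP i (tree_size A)) => [le|gt]; first exact: LeafInLeft.
by rewrite -(subnKC gt); exact: LeafInRight.
Qed.

Lemma size_graft (T S : bintree) i : i <= tree_size T ->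
  tree_size (graft T i.+1 S) = tree_size T + tree_size S.
Proof.
elim: T i => // A IHA B IHB i.
case: (leafP A B i) => [{}i le _|{}i le].
  by rewrite graft_left //= IHA //; lia.
by rewrite graft_right /= IHB; move: le => /=; lia.
Qed.

(** The position [i] of [graft T i.+1 S] is the leaf between the vertices
    [i - 1] and [i] of [T]; it belongs to the right subtree of [k < i] exactly
    when this subtree reaches the vertex [i - 1], whence the off-by-one. *)
Lemma rsize_graft_before (T S : bintree) i k : i <= tree_size T -> k < i ->
  rsize (graft T i.+1 S) k
  = rsize T k + (if i <= (k + rsize T k).+1 then tree_size S else 0).
Proof.
elim: T i k => [|A IHA B IHB] i k; first by case: i.
case: (leafP A B i) => [{}i le _ ki|{}i lei].
  by rewrite graft_left // rsize_lt ?size_graft ?IHA ?rsize_lt //; lia.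
rewrite graft_right; case: (nodeP A B k) => [{}k lt||{}k] ki.
- by rewrite !rsize_lt // ifF; have := rsize_bound lt; lia.
- by rewrite !rsize_root size_graft ?ifT //; move: lei => /=; lia.
- rewrite !rsize_gt IHB; [|move: lei => /=; lia|lia].
  by do 2! case: ifP; lia.
Qed.

Lemma rsize_graft_inside (T S : bintree) i k : i <= tree_size T ->
  k < tree_size S -> rsize (graft T i.+1 S) (i + k) = rsize S k.
Proof.
elim: T i => [|A IHA B IHB] i; first by case: i.
case: (leafP A B i) => [{}i le _ lt|{}i lei lt].
  by rewrite graft_left // rsize_lt ?size_graft ?IHA //; lia.
by rewrite graft_right -addnA rsize_gt IHB //; move: lei => /=; lia.
Qed.

Lemma rsize_graft_after (T S : bintree) i k : i <= k ->
  k < tree_size T -> rsize (graft T i.+1 S) (k + tree_size S) = rsize T k.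
Proof.
elim: T i k => [|A IHA B IHB] i k //.
case: (leafP A B i) => [{}i le ik|{}i]; last first.
  rewrite graft_right; case: (nodeP A B k) => [{}k||{}k]; [lia..|].
  by rewrite -addnA !rsize_gt => ? /= ?; rewrite IHB //; lia.
rewrite graft_left //; have szg := size_graft S le.
case: (nodeP A B k) ik => [{}k lt||{}k] ik ltk.
- by rewrite !rsize_lt ?szg ?IHA //; lia.
- by rewrite -szg !rsize_root.
- have -> : (tree_size A).+1 + k + tree_size S
          = (tree_size (graft A i.+1 S)).+1 + k by lia.
  by rewrite !rsize_gt.
Qed.

Lemma lsize_graft (T S : bintree) i : i < tree_size T ->
  0 < tree_size S -> tree_size S <= lsize (graft T i.+1 S) (i + tree_size S).
Proof.
move=> lt pos.
suff : i + tree_size S <= i + lsize (graft T i.+1 S) (i + tree_size S) by lia.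
apply/lsize_rsizeP => [||k ik ki]; rewrite ?size_graft; try lia.
rewrite -(subnKC ik) rsize_graft_inside; try lia.
by have := @rsize_bound S (k - i); lia.
Qed.

(** Deleting a common grafted block keeps the comparison of right sizes: if the
    block is counted for [k] in [S1] but not in [T1], then the right subtree of
    [k] in [graft S1 i.+1 S2] is already longer than the one in
    [graft T1 i.+1 T2]. *)
Lemma tamari_le_graft (S1 S2 T1 T2 : bintree) i :
  tree_size S1 = tree_size T1 -> tree_size S2 = tree_size T2 ->
  i <= tree_size T1 -> 0 < tree_size T2 ->
  tamari_le (graft S1 i.+1 S2) (graft T1 i.+1 T2) ->
  tamari_le S1 T1 /\ tamari_le S2 T2.
Proof.
move=> sz1 sz2 iT pos /tamari_le_size_rsize[_]; rewrite size_graft ?sz1 // => h.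
split; apply: rsize_tamari_le => // k kS.
- case: (ltnP k i) => ki.
    have := h k; rewrite !rsize_graft_before ?sz1 // sz2.
    by case: ifP; case: ifP; lia.
  have := h (k + tree_size T2).
  by rewrite -{2}sz2 !rsize_graft_after -?sz1 //; apply; lia.
- have := h (i + k).
  by rewrite !rsize_graft_inside ?sz1 -?sz2 //; apply; lia.
Qed.

(** A tree is the grafting of any of its subtrees on what remains. *)
Lemma subtree_graft (T : bintree) m : m < tree_size T ->
  exists T1 T2, [/\ T = graft T1 (m - lsize T m).+1 T2,
    tree_size T2 = (lsize T m + rsize T m).+1,
    tree_size T = tree_size T1 + tree_size T2 & m - lsize T m <= tree_size T1].
Proof.
elim: T m => // A IHA B IHB m.
case: (nodeP A B m) => [{}m lt _||{}m ltm].
- have [A1 [A2 [eA sz2 sz le]]] := IHA m lt.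
  exists (Node A1 B), A2; rewrite lsize_lt // rsize_lt // graft_left // -eA.
  by split=> //=; lia.
- move=> _; exists Leaf, (Node A B); rewrite lsize_root rsize_root.
  by split=> //=; lia.
- have lt : m < tree_size B by move: ltm => /=; lia.
  have [B1 [B2 [eB sz2 sz le]]] := IHB m lt.
  exists (Node A B1), B2; rewrite lsize_gt rsize_gt.
  rewrite -addnBA ?lsize_bound // graft_right -eB.
  by split=> //=; lia.
Qed.

(** A criterion on [rsize] alone for [c, ..., d] to be the vertex set of a
    subtree.  Its root is the first vertex [m] of the block whose right subtree
    reaches [d]; the left subtree of [m] starts at [c] because [m] is in the
    right subtree of [c - 1]. *)
Lemma rsize_subtree (S : bintree) c d : c <= d < tree_size S ->
  (0 < c -> d <= c.-1 + rsize S c.-1) ->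
  (forall i, c <= i <= d -> i + rsize S i <= d) ->
  exists m, [/\ m < tree_size S, m - lsize S m = c & m + rsize S m = d].
Proof.
move=> /andP[cd dn] left_ right_.
have ex : exists k, (c <= k <= d) && (d <= k + rsize S k).
  by exists d; rewrite cd leqnn leq_addr.
case: (ex_minnP ex) => m /andP[/andP[cm md] dm] mmin.
have md' : m + rsize S m = d by have := right_ m; lia.
have mn : m < tree_size S by lia.
exists m; split=> //.
have lb := lsize_bound mn.
have upper : m - lsize S m <= c.
  case: (ltnP c m) => [ltcm|]; last by lia.
  suff : m <= c + lsize S m by lia.
  apply/lsize_rsizeP => // k ck km.
  by have := mmin k; have := @rsize_nest S k m; lia.
case: (posnP c) => [|c0]; first by lia.
have ltc : c.-1 < m by lia.
have [/(_ _ c.-1) h _] := lsize_rsizeP ltc mn.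
by have := left_ c0; lia.
Qed.

Lemma lsize_subtree (T : bintree) c d : c <= d < tree_size T ->
  (d.+1 < tree_size T -> d.+1 <= c + lsize T d.+1) ->
  (forall i, c <= i <= d -> c <= i - lsize T i) ->
  exists m, [/\ m < tree_size T, m - lsize T m = c & m + rsize T m = d].
Proof.
move=> /andP[cd dn] right_ left_; pose n := tree_size T.
have [|c0|i ci|m []] := @rsize_subtree (mirror T) (n.-1 - d) (n.-1 - c).
- by rewrite size_mirror /n; lia.
- rewrite rsize_mirror; last by rewrite /n; lia.
  have -> : n.-1 - (n.-1 - d).-1 = d.+1 by rewrite /n in c0 *; lia.
  by have := right_; rewrite /n in c0 *; lia.
- rewrite rsize_mirror; last by rewrite /n in ci *; lia.
  have := left_ (n.-1 - i); have := @lsize_bound T (n.-1 - i).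
  by rewrite /n in ci *; lia.
rewrite size_mirror => mn; rewrite lsize_mirror // rsize_mirror // => e1 e2.
exists (n.-1 - m); have := @lsize_bound T (n.-1 - m).
have := @rsize_bound T (n.-1 - m).
by rewrite /n in e1 e2 *; split; lia.
Qed.

(** Graftings come from proper common subtrees.  The hypotheses are arranged so
    that only right sizes of the lower tree and left sizes of the upper tree
    occur, as in an interval-poset. *)
Lemma common_subtree_grafting (n : nat) (S T : bintree) c d :
  tamari_interval n (S, T) -> c <= d < n -> (0 < c) || (d.+1 < n) ->
  (0 < c -> d <= c.-1 + rsize S c.-1) ->
  (forall i, c <= i <= d -> i + rsize S i <= d) ->
  (d.+1 < n -> d.+1 <= c + lsize T d.+1) ->
  (forall i, c <= i <= d -> c <= i - lsize T i) ->
  is_grafting (S, T).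
Proof.
move=> [/= szS szT le] cd proper hS1 hS2 hT1 hT2.
have [|//|//|m [mS mc md]] := @rsize_subtree S c d; first by rewrite szS.
have [||//|m' [mT mc' md']] := @lsize_subtree T c d; rewrite ?szT //.
have [S1 [S2 [eS szS2 sS leS]]] := subtree_graft mS.
have [T1 [T2 [eT szT2 sT leT]]] := subtree_graft mT.
rewrite mc in eS leS; rewrite mc' in eT leT.
have bS := lsize_bound mS; have bT := lsize_bound mT.
have e2 : tree_size S2 = tree_size T2 by lia.
have e1 : tree_size S1 = tree_size T1 by lia.
have pos : 0 < tree_size T2 by lia.
have [le1 le2] : tamari_le S1 T1 /\ tamari_le S2 T2.
  by apply: (tamari_le_graft e1 e2 leT pos); rewrite -eS -eT.
exists (tree_size T1), (tree_size T2), c.+1, (S1, T1), (S2, T2).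
split; first by split; lia.
by split; [split..|rewrite /graft_interval /= -eS -eT].
Qed.

(** * The shape of new intervals *)

(** Let [k] be the root of the upper tree.  No vertex before [k] has [k] in its
    right subtree there, hence neither in the lower tree; if [k > 0], then
    [0, ..., k - 1] is therefore a subtree of both.  The argument for the right
    subtree of the root of the lower tree is dual. *)
Lemma new_interval_rise (n : nat) (I : bintree * bintree) :
  new_interval n.+1 I ->
  exists S T, [/\ tree_size S = n, tree_size T = n &
    I = (Node S Leaf, Node Leaf T)].
Proof.
case: I => S' T' [itv new]; have [/= szS szT le] := itv.
have [_ leR] := tamari_le_size_rsize le.
have free : clash_free S' T' by apply/tamari_leP; rewrite ?szS.
case: S' szS le leR free itv new => [//|S B] [szS] le leR free itv new.
case: T' szT le leR free itv new => [//|A T] [szT] le leR free itv new.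
have B0 : B = Leaf.
  case: B => [//|B1 B2] in szS le leR free itv new *; case: new.
  apply: (common_subtree_grafting (c := (tree_size S).+1) (d := n) itv) => //.
  - by move: szS => /=; lia.
  - by rewrite /= ltnn eqxx -szS /=; lia.
  - move=> i /andP[ci cn]; have := @rsize_bound (Node S (Node B1 B2)) i.
    by move: szS => /=; lia.
  - by lia.
  - move=> i /andP[ci cn].
    have := free (tree_size S) i.
    by rewrite rsize_root; move: szS => /=; lia.
have A0 : A = Leaf.
  case: A => [//|A1 A2] in szT le leR free itv new *; case: new.
  pose k := tree_size (Node A1 A2).
  apply: (common_subtree_grafting (c := 0) (d := k.-1) itv) => //.
  - by move: szT; rewrite /k /=; lia.
  - by move: szT; rewrite /k /=; lia.
  - move=> i /andP[_ ik].
    have lt : i < k by rewrite /k /= in ik *; lia.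
    have := leR i; rewrite (rsize_lt _ lt).
    have := rsize_bound lt; rewrite -/k.
    by move: szT; rewrite /k /=; lia.
  - have -> : k.-1.+1 = k by [].
    by move=> _; rewrite lsize_root.
by subst A B; exists S, T; split=> //; move: szS szT => /=; lia.
Qed.

(** No vertex has both a right child in [S] and a left child in [T]: in the
    interval-poset these would give relations [y - 1 <| y] and [y + 1 <| y]. *)
Definition modern_pair (S T : bintree) : Prop :=
  forall y, y < tree_size S -> 0 < rsize S y -> 0 < lsize T y -> False.

Lemma lsize_rise (T : bintree) i : lsize (Node Leaf T) i.+1 = lsize T i.
Proof. exact: (lsize_gt Leaf T i). Qed.

(** If [y] violates modernity, then [y] and [y + 1] clash in the larger trees.
    For clash-freeness, a clash [a, b] of [S, T] with [b - a] minimal yields the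
    common subtree [a + 1, ..., b] of the larger trees: a vertex of this block
    whose right subtree in the lower tree or left subtree in the upper one
    leaves the block would create a shorter clash or violate modernity. *)
Lemma new_rise_modern (n : nat) (S T : bintree) :
  tree_size S = n -> tree_size T = n ->
  new_interval n.+1 (Node S Leaf, Node Leaf T) ->
  clash_free S T /\ modern_pair S T.
Proof.
move=> szS szT [itv new]; have [/= szS' szT' le] := itv.
have {le} free : clash_free (Node S Leaf) (Node Leaf T).
  by apply/tamari_leP; rewrite //= szS szT addn0.
have mod : modern_pair S T.
  move=> y lt rpos lpos; have := free y y.+1.
  by rewrite rsize_lt // lsize_rise /=; lia.
split=> // a b.
(* induction on [b - a] replaces the choice of a shortest clash *)
have [d] := ubnP (b - a); elim: d a b => // d IH a b bd ab bn leR leL.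
apply: new; apply: (common_subtree_grafting (c := a.+1) (d := b) itv) => //=.
- by lia.
- by move=> _; have := @rsize_lt S Leaf a; rewrite /= => ->; lia.
- move=> i /andP[ai ib]; have lt : i < tree_size S by lia.
  have := rsize_lt Leaf lt; rewrite /= => ->.
  case: (leqP (i + rsize S i) b) => // gt; exfalso.
  case: (ltngtP i b) ib => // [ib|eib] _.
    by apply: (IH i b); lia.
  by apply: (mod b); [lia|rewrite -eib; lia|lia].
- by rewrite subn1 /=; lia.
- case=> // j /andP[]; rewrite ltnS subn1 /= => aj jb.
  have lb : lsize T j <= j by apply: lsize_bound; lia.
  case: (leqP (a + lsize T j) j) => gt; first by lia.
  exfalso; case: (ltngtP a j) aj => // [lt|eaj] _.
    by apply: (IH a j); lia.
  by apply: (mod a); [lia|lia|rewrite eaj; lia].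
Qed.

(** A clash [a, b] of the larger trees is a clash [a, b - 1] of [S, T], or a
    violation of modernity when [b = a + 1].  A common subtree
    [i, ..., i + q - 1] of the larger trees gives the clash
    [i - 1, i + q - 1] of [S, T].  This block is not at either end: the vertex 0
    is the root of the upper tree and the vertex [n] that of the lower one, and a
    proper subtree contains no root. *)
Lemma modern_rise_new (n : nat) (S T : bintree) :
  tree_size S = n -> tree_size T = n ->
  clash_free S T -> modern_pair S T ->
  new_interval n.+1 (Node S Leaf, Node Leaf T).
Proof.
move=> szS szT free mod; split.
  rewrite /tamari_interval /=; split; [by rewrite szS addn0|by rewrite szT|].
  apply/tamari_leP => [|a [|b]] //=; first by lia.
  rewrite ltnS => ab bn; have lt : a < tree_size S by lia.
  have := rsize_lt Leaf lt; have := lsize_rise T b; rewrite /= => -> -> leR leL.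
  case: (ltngtP a b) ab => // [lt_ab|eab] _.
    by apply: (free a b); lia.
  by apply: (mod a); [lia|lia|rewrite eab; lia].
move=> [p [q [[|i] [[S1 T1] [[S2 T2] [[p1 q1 /andP[// _ ip]]]]]]]].
move=> [[/= sS1 sT1 _] [/= sS2 sT2 _] [eS eT]].
have sz : n.+1 = p + q.
  by rewrite -sS1 -sS2 -(@size_graft S1 S2 i) ?sS1 // -eS /= szS addn0.
have leR : 0 < i -> q <= rsize (Node S Leaf) i.-1.
  by move=> i0; rewrite eS rsize_graft_before ?sS1 ?sS2 ?ifT; lia.
have leL : i < p -> q <= lsize (Node Leaf T) (i + q).
  by move=> ltp; rewrite eT -{1 2}sT2; apply: lsize_graft; lia.
have iq : i + q = (i + q).-1.+1 by lia.
rewrite iq lsize_rise in leL.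
have lb := @lsize_bound T (i + q).-1.
case: (posnP i) => [i0|i0]; first by lia.
have lt : i.-1 < tree_size S by lia.
rewrite rsize_lt // in leR; have rb := rsize_bound lt.
case: (ltnP i p) => [ltp|]; last by lia.
by apply: (free i.-1 (i + q).-1); lia.
Qed.

(** * Interval-posets of pairs of trees *)

Definition interval_graph (n : nat) (S T : bintree) : {set 'I_n * 'I_n} :=
  [set p : 'I_n * 'I_n |
    if p.2 <= p.1 then p.1 <= p.2 + rsize S p.2 else p.2 <= p.1 + lsize T p.2].

Lemma interval_graphE n (S T : bintree) (a b : 'I_n) :
  graph_rel (interval_graph n S T) a b
  = if b <= a then a <= b + rsize S b else b <= a + lsize T b.
Proof. by rewrite /graph_rel inE. Qed.

(** Transitivity also has to compose relations of opposite directions.  If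
    [a <| b] and [b <| c] with [a, c < b], then [c] and [b] do not clash, so the
    left subtree of [b] in [T] starts after [c]; hence [c < a < b], and [a] is in
    the right subtree of [c] along with [b].  The case [b < a, c] is dual. *)
Lemma interval_graph_poset n (S T : bintree) :
  tree_size S = n -> tree_size T = n -> clash_free S T ->
  interval_poset (interval_graph n S T).
Proof.
move=> szS szT free; split.
- by move=> a; rewrite interval_graphE leqnn leq_addr.
- move=> a b; rewrite !interval_graphE => /andP[].
  case: (ltngtP a b) => [ab|ba|ab] h1 h2; last exact: val_inj.
  + by case: (free a b ab); rewrite ?szS.
  + by case: (free b a ba); rewrite ?szS.
- move=> b a c; rewrite !interval_graphE.
  have lta := ltn_ord a; have ltb := ltn_ord b; have ltc := ltn_ord c.
  have nestR := @rsize_nest S c b; have nestL := @lsize_nest T c b.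
  have freecb := free c b; have freebc := free b c.
  by case: (ltngtP b a) => [?|?|/val_inj ?];
    case: (ltngtP c b) => [?|?|/val_inj ?];
    case: (ltngtP c a) => [?|?|/val_inj ?]; subst; lia.
- by move=> a b c ab bc; rewrite !interval_graphE; do 2! case: ifP; lia.
- by move=> a b c ab bc; rewrite !interval_graphE; do 2! case: ifP; lia.
Qed.

Lemma interval_graph_clash_free n (S T : bintree) :
  tree_size S = n -> interval_poset (interval_graph n S T) -> clash_free S T.
Proof.
move=> szS [_ anti _ _ _] a b ab bn leR leL.
rewrite szS in bn; have an : a < n by lia.
have : Ordinal an = Ordinal bn.
  apply: anti; rewrite !interval_graphE /=.
  by rewrite [b <= a]leqNgt ab (ltnW ab) leR leL.
by move=> [] eab; rewrite eab ltnn in ab.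
Qed.

Lemma modern_interval_graph n (S T : bintree) :
  tree_size S = n -> tree_size T = n ->
  modern (interval_graph n S T) <-> modern_pair S T.
Proof.
rewrite /modern /= => szS szT; split=> [mod y yn rpos lpos|mod [x [y [z []]]]].
  have lb : lsize T y <= y by apply: lsize_bound; lia.
  have rb := rsize_bound yn.
  have xn : y.-1 < n by lia.
  have yn' : y < n by lia.
  have zn : y.+1 < n by lia.
  apply: mod; exists (Ordinal xn), (Ordinal yn'), (Ordinal zn).
  rewrite !interval_graphE /=; split; try lia.
    by rewrite ifF; lia.
  by rewrite ifT; lia.
rewrite !interval_graphE => xy yz.
by have := mod y; rewrite szS ltn_ord; do 2! case: ifP; lia.
Qed.

Lemma interval_graph_inj n (S T S' T' : bintree) :
  tree_size S = n -> tree_size T = n -> tree_size S' = n -> tree_size T' = n ->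
  interval_graph n S T = interval_graph n S' T' -> S = S' /\ T = T'.
Proof.
move=> szS szT szS' szT' eG.
have eR a b : a < b -> b < n -> (b <= a + rsize S a) = (b <= a + rsize S' a).
  move=> ab bn; have an : a < n by lia.
  have := interval_graphE S' T' (Ordinal bn) (Ordinal an).
  by rewrite -eG interval_graphE /= (ltnW ab).
have eL a b : a < b -> b < n -> (b <= a + lsize T b) = (b <= a + lsize T' b).
  move=> ab bn; have an : a < n by lia.
  have := interval_graphE S' T' (Ordinal an) (Ordinal bn).
  by rewrite -eG interval_graphE /= [b <= a]leqNgt ab.
split; [apply: rsize_inj|apply: lsize_inj]; rewrite ?szS ?szT // => i lt.
- have := @rsize_bound S i; have := @rsize_bound S' i.
  by have := eR i (i + rsize S i); have := eR i (i + rsize S' i); lia.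
- have := @lsize_bound T i; have := @lsize_bound T' i.
  by have := eL (i - lsize T i) i; have := eL (i - lsize T' i) i; lia.
Qed.

(** The two closure conditions on an interval-poset say that its decreasing
    relations describe initial segments and its increasing ones final segments,
    so each kind is realized by a tree. *)
Lemma interval_graph_surj n (P : {set 'I_n * 'I_n}) : interval_poset P ->
  exists S T, [/\ tree_size S = n, tree_size T = n & P = interval_graph n S T].
Proof.
case=> refl anti trans up down.
pose D (a b : nat) := if insub a is Some x then
  if insub b is Some y then graph_rel P x y else false else false.
have DE (a b : 'I_n) : D a b = graph_rel P a b by rewrite /D !valK.
have ord3 a b c : a < b -> b < c -> c < n ->
    exists x y z : 'I_n, [/\ a = x, b = y & c = z].
  move=> ab bc cn; have bn := ltn_trans bc cn.
  by exists (Ordinal (ltn_trans ab bn)), (Ordinal bn), (Ordinal cn).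
have [||S [szS hS]] := @rsize_realize n (fun a b => D b a).
- move=> a b c ab bc cn; have [x [y [z [? ? ?]]]] := ord3 _ _ _ ab bc cn; subst.
  by rewrite !DE; apply: down.
- move=> a b c ab bc cn; have [x [y [z [? ? ?]]]] := ord3 _ _ _ ab bc cn; subst.
  by rewrite !DE => h1 h2; apply: trans h2 h1.
have [||T [szT hT]] := @lsize_realize n (fun b a => D a b).
- move=> a b c ab bc cn; have [x [y [z [? ? ?]]]] := ord3 _ _ _ ab bc cn; subst.
  by rewrite !DE; apply: up.
- move=> a b c ab bc cn; have [x [y [z [? ? ?]]]] := ord3 _ _ _ ab bc cn; subst.
  by rewrite !DE => h1 h2; apply: trans h2 h1.
exists S, T; split=> //; apply/setP => -[a b].
rewrite inE /=; case: (ltngtP a b) => [ab|ba|/val_inj ->].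
- by rewrite hT // DE.
- by rewrite hS // DE.
- by rewrite leq_addr; exact: refl.
Qed.

Definition poset_of_rise (n : nat) (I : bintree * bintree) :
    {set 'I_n * 'I_n} :=
  match I with
  | (Node A _, Node _ B) => interval_graph n A B
  | _ => finset.set0
  end.

Theorem corollary4p17 (n : nat) :
  exists f : bintree * bintree -> {set 'I_n * 'I_n},
    set_bij [set I | new_interval n.+1 I]%classic
            [set P | interval_poset P /\ modern P]%classic f.
Proof.
exists (@poset_of_rise n); split.
- move=> I /= newI.
  have [S [T [szS szT eI]]] := new_interval_rise newI; rewrite eI /= in newI *.
  have [free mod] := new_rise_modern szS szT newI.
  split; first exact: interval_graph_poset.
  by apply/modern_interval_graph.
- move=> I J; rewrite !inE /= => newI newJ.
  have [S [T [szS szT ->]]] := new_interval_rise newI.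
  have [S' [T' [szS' szT' ->]]] := new_interval_rise newJ.
  by move=> /= /interval_graph_inj[] // -> ->.
- move=> P [/= posP modP].
  have [S [T [szS szT eP]]] := interval_graph_surj posP; subst P.
  exists (Node S Leaf, Node Leaf T) => //=.
  apply: modern_rise_new => //; first exact: interval_graph_clash_free posP.
  exact/(modern_interval_graph szS szT).
Qed.
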